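(* Let $\phi$ be a 1-coercive and Legendre dgf on $\mathbb R^n$, $X=\operatorname{dom}\phi$, $Y=\operatorname{int}\operatorname{dom}\phi$, and let $f:X\to\overline{\mathbb R}$ be proper, lsc, and $\phi$-prox-bounded with threshold $\lambda_f$. Then, for any $\lambda\in(0,\lambda_f)$, $\bar x\in\operatorname{int}X$, $\bar u\in\mathbb R^n$, and denoting $\bar y=\nabla\phi^*(\lambda\bar u+\nabla\phi(\bar x))$, the following are equivalent: (a) $\bar u\in\overleftarrow{\partial}_\lambda f(\bar x)$. (b) $\bar x\in\overleftarrow{\mathrm{prox}}_{\lambda f}(\bar y)$. (c) $\frac{\bar x-\bar y}{\lambda}\in\overrightarrow{\partial}_\lambda(-\overleftarrow{\mathrm{env}}_\lambda f)(\bar y)$ and $\bar x\in\operatorname{dom}\overleftarrow{\partial}_\lambda f$. (d) $\bar y\in\overrightarrow{\mathrm{prox}}_{\lambda g}(\bar x)$ with $g=-\overleftarrow{\mathrm{env}}_\lambda f$, and $\bar x\in\operatorname{dom}\overleftarrow{\partial}_\lambda f$. (e) $\bar x\in\overleftarrow{\mathrm{prox}}_{\lambda h}(\bar y)$ with $h=\mathrm{hull}_\lambda f$, and $\mathrm{hull}_\lambda f(\bar x)=f(\bar x)$. (f) $\bar u\in\partial(\mathrm{hull}_\lambda f)(\bar x)$ and $\mathrm{hull}_\lambda f(\bar x)=f(\bar x)$. (g) $\nabla\phi(\bar y)\in\partial\bigl[\operatorname{conv}(\lambda f+\phi)\bigr](\bar x)$ and $\operatorname{conv}(\lambda f+\phi)(\bar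 x)=(\lambda f+\phi)(\bar x)$.
   Context: $\overline{\mathbb R}=[-\infty,\infty]$. A distance-generating function (dgf) is a proper, lsc, convex $\phi:\mathbb R^n\to\overline{\mathbb R}$ differentiable on $\operatorname{int}\operatorname{dom}\phi\neq\emptyset$. $\phi^*$ is its convex conjugate. $D_\phi(x,y)=\phi(x)-\phi(y)-\langle\nabla\phi(y),x-y\rangle$ if $y\in Y$, and $\infty$ otherwise. $\phi$ is Legendre if it is essentially smooth (differentiable on $Y\ne\emptyset$ with $\|\nabla\phi(x^k)\|\to\infty$ whenever $Y\ni x^k\to x\in\operatorname{bdry}\operatorname{dom}\phi$) and essentially strictly convex (strictly convex on every convex subset of $\operatorname{dom}\partial\phi$). $\phi$ is 1-coercive if $\liminf_{\|x\|\to\infty}\phi(x)/\|x\|=\infty$. $f:X\to\overline{\mathbb R}$ is proper if not identically $\infty$ and never $-\infty$; lsc is meant relative to $X$. $\lambda f+\phi$ is a function on $X$; $\operatorname{conv}h$ is the pointwise supremum of all convex functions $X\to\overline{\mathbb R}$ majorized by $h$. For $h:X\to\overline{\mathbb R}$, with all points and limits in $X$: Fréchet subdifferential $\hat\partial h(x)=\{v:\liminf_{z\to x,z\ne x}\frac{h(z)-h(x)-\langle v,z-x\rangle}{\|z-x\|}\ge0\}$; limiting subdifferential $\partial h(x)=\{v:\exists (x^k,v^k)\in\operatorname{gph}\hat\partial h,\ (x^k,h(x^k),v^k)\to(x,h(x),v)\}$ if $h(x)<\infty$, and $\emptyset$ otherwise. For $f:X\to\overline{\mathbb R}$, $g:Y\to\overline{\mathbb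 R}$, $\bar y\in Y$, $\bar x\in X$: $\overleftarrow{\mathrm{prox}}_{\lambda f}(\bar y)=\operatorname{argmin}_{x\in X}\{f(x)+\frac1\lambda D_\phi(x,\bar y)\}$, and $\overleftarrow{\mathrm{env}}_\lambda f(\bar y)$ is the corresponding infimum; $\overrightarrow{\mathrm{prox}}_{\lambda g}(\bar x)=\operatorname{argmin}_{y\in Y}\{g(y)+\frac1\lambda D_\phi(\bar x,y)\}$, and $\overrightarrow{\mathrm{env}}_\lambda g(\bar x)$ is the corresponding infimum; $\mathrm{hull}_\lambda f=-\overrightarrow{\mathrm{env}}_\lambda(-\overleftarrow{\mathrm{env}}_\lambda f):X\to\overline{\mathbb R}$. $f$ is $\phi$-prox-bounded if $\overleftarrow{\mathrm{env}}_\lambda f(y)>-\infty$ for some $\lambda>0$, $y\in Y$; $\lambda_f$ is the supremum of all such $\lambda$. Left Bregman level proximal subdifferential: $\bar u\in\overleftarrow{\partial}_\lambda f(\bar x)$ iff $\bar x\in\operatorname{int}X$ and $f(x)\ge f(\bar x)+\langle\bar u,x-\bar x\rangle-\frac1\lambda D_\phi(x,\bar x)$ for all $x\in X$. Right one: for $\bar y\in Y$, $\bar v\in\overrightarrow{\partial}_\lambda g(\bar y)$ iff $g(y)\ge g(\bar y)+\langle\bar v,\nabla\phi(y)-\nabla\phi(\bar y)\rangle-\frac1\lambda D_\phi(\bar y,y)$ for all $y\in Y$. $\operatorname{dom}T=\{x:T(x)\neq\emptyset\}$. *)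

(* Defs.v *)
(* R^n is 'rV[R]_n with R : realType. *)
From HB Require Import structures.
From mathcomp Require Import all_boot all_order all_algebra.
From mathcomp Require Import all_classical all_reals all_analysis.

Set Implicit Arguments.
Unset Strict Implicit.
Unset Printing Implicit Defensive.

Import Order.TTheory GRing.Theory Num.Theory.
Import numFieldNormedType.Exports.

Local Open Scope classical_set_scope.
Local Open Scope ring_scope.

(* A function h : A -> [-oo, +oo] on a subset A of R^n is represented by a total
   function 'rV[R]_n -> \bar R together with A; the definitions below only read
   its values on A. *)

Section Euclidean.
Context {R : realType} {n : nat}.
Implicit Types x y : 'rV[R]_n.

Definition dot x y : R := \sum_i x 0 i * y 0 i.

(* The norm `|x| that the library puts on 'rV[R]_n is the sup norm. *)
Definition enorm x : R := Num.sqrt (dot x x).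

Definition enorm_infty : set_system 'rV[R]_n :=
  filter_from [set: R] (fun M => [set x | M < enorm x]).

End Euclidean.

Section ExtendedReal.
Context {R : realType} {n : nat}.
Implicit Types (h : 'rV[R]_n -> \bar R) (A C : set 'rV[R]_n) (x v : 'rV[R]_n).

Definition edom h : set 'rV[R]_n := [set x | h x < +oo]%E.

Definition proper_on A h :=
  (exists2 x, A x & (h x < +oo)%E) /\ (forall x, A x -> (-oo < h x)%E).

Definition lsc_on A h := lower_semicontinuous (h : subspace A -> \bar R).

(* The dual addition satisfies -oo + +oo = +oo, the convention under which this
   inequality is convexity of the epigraph. *)
Definition convex_on A h := forall x y (t : R), A x -> A y -> 0 < t < 1 ->
  (h (t *: x + (1 - t) *: y)%R
     <= dual_adde (t%:E * h x) ((1 - t)%R%:E * h y))%E.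

Definition strictly_convex_on A h :=
  forall x y (t : R), A x -> A y -> x != y -> 0 < t < 1 ->
  (h (t *: x + (1 - t) *: y)%R < t%:E * h x + (1 - t)%R%:E * h y)%E.

Definition conv_on A h x : \bar R :=
  ereal_sup [set k x | k in
    [set k | convex_on A k /\ forall z, A z -> (k z <= h z)%E]].

Definition argmin_on A h : set 'rV[R]_n :=
  [set x | A x /\ forall z, A z -> (h x <= h z)%E].

(* Meaningful where h is finite and differentiable near x. *)
Definition grad h x : 'rV[R]_n :=
  \row_(i < n) ('d (fine \o h) x : 'rV[R]_n -> R^o) (delta_mx 0 i).

Definition conjugate h v : \bar R :=
  ereal_sup [set ((dot v x)%:E - h x)%E | x in [set: 'rV[R]_n]].

(* Finiteness of h x is required for the difference quotient to make sense. *)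
Definition frechet_subdiff A h x : set 'rV[R]_n :=
  [set v | [/\ A x, h x \is a fin_num &
    (0 <= limf_einf
       (fun z => (h z - h x - (dot v (z - x)%R)%:E) * ((enorm (z - x)%R)^-1)%R%:E)
       (within A (dnbhs x)))%E]].

Definition limiting_subdiff A h x : set 'rV[R]_n :=
  [set v | [/\ A x, (h x < +oo)%E &
    exists x_ v_ : nat -> 'rV[R]_n,
      [/\ forall k, frechet_subdiff A h (x_ k) (v_ k),
          x_ @ \oo --> x,
          h \o x_ @ \oo --> h x &
          v_ @ \oo --> v]]].

Definition set_dom (T : 'rV[R]_n -> set 'rV[R]_n) : set 'rV[R]_n :=
  [set x | T x !=set0].

Definition one_coercive h :=
  limf_einf (fun x => h x * ((enorm x)^-1)%R%:E)%E enorm_infty = +oo%E.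

Definition dgf h :=
  [/\ proper_on setT h, lower_semicontinuous h, convex_on setT h,
      (edom h)° !=set0 &
      forall x, (edom h)° x -> differentiable (fine \o h : 'rV[R]_n -> R^o) x].

Definition essentially_smooth h :=
  [/\ (edom h)° !=set0,
      forall x, (edom h)° x -> differentiable (fine \o h : 'rV[R]_n -> R^o) x &
      forall (x_ : nat -> 'rV[R]_n) x,
        (forall k, (edom h)° (x_ k)) ->
        (closure (edom h) `\` (edom h)°) x ->
        x_ @ \oo --> x ->
        enorm (grad h (x_ k)) @[k --> \oo] --> +oo].

Definition essentially_strictly_convex h :=
  forall C, convex_set (C : set (convex_lmodType 'rV[R]_n)) ->
    C `<=` set_dom (limiting_subdiff setT h) -> strictly_convex_on C h.

Definition legendre h := essentially_smooth h /\ essentially_strictly_convex h.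

End ExtendedReal.

Section Bregman.
Context {R : realType} {n : nat}.
Variable phi : 'rV[R]_n -> \bar R.
Implicit Types (f g : 'rV[R]_n -> \bar R) (x y u v : 'rV[R]_n) (lambda : R).

Local Notation X := (edom phi).
Local Notation Y := (edom phi)°.

Definition bregman x y : \bar R :=
  if `[< Y y >] then (phi x - phi y - (dot (grad phi y) (x - y)%R)%:E)%E
  else +oo%E.

Definition left_prox lambda f y : set 'rV[R]_n :=
  argmin_on X (fun x => f x + lambda^-1%R%:E * bregman x y)%E.

Definition left_env lambda f y : \bar R :=
  ereal_inf [set (f x + lambda^-1%R%:E * bregman x y)%E | x in X].

Definition right_prox lambda g x : set 'rV[R]_n :=
  argmin_on Y (fun y => g y + lambda^-1%R%:E * bregman x y)%E.

Definition right_env lambda g x : \bar R :=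
  ereal_inf [set (g y + lambda^-1%R%:E * bregman x y)%E | y in Y].

Definition hull lambda f x : \bar R :=
  (- right_env lambda (fun y => - left_env lambda f y) x)%E.

Definition prox_bound_params f : set R :=
  [set lambda | 0 < lambda /\ exists2 y, Y y & (-oo < left_env lambda f y)%E].

Definition prox_bounded f := prox_bound_params f !=set0.

Definition prox_threshold f : \bar R :=
  ereal_sup [set lambda%:E | lambda in prox_bound_params f].

Definition left_level_subdiff lambda f x : set 'rV[R]_n :=
  [set u | Y x /\ forall z, X z ->
    (f x + (dot u (z - x)%R)%:E - lambda^-1%R%:E * bregman z x <= f z)%E].

Definition right_level_subdiff lambda g y : set 'rV[R]_n :=
  [set v | Y y /\ forall z, Y z ->
    (g y + (dot v (grad phi z - grad phi y)%R)%:E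
       - lambda^-1%R%:E * bregman y z <= g z)%E].

End Bregman.

(* Main.v *)
Require Import Defs.
From HB Require Import structures.
From mathcomp Require Import all_boot all_order all_algebra.
From mathcomp Require Import all_classical all_reals all_analysis.
From mathcomp Require Import ring lra.

(** Write F for [lambda f + phi] on X, and w for
    [lambda *: ubar + grad phi xbar]. All seven conditions say that the affine
    function of slope w through (xbar, F(xbar)) lies below F.

    The passage between ubar and ybar rests on one fact about phi:
    1-coercivity and the Legendre property make [grad phi] a bijection from the
    interior Y onto the whole space, with inverse the gradient of the
    conjugate ([grad_conjugate_inverse]), so that ybar is in Y and
    [grad phi ybar = w]. Coercivity gives each w a point p at which w is a
    subgradient of phi, essential smoothness puts p inside Y, and strict
    convexity makes phi leave its tangent plane at p at a linear rate away
    from p ([subgradient_growth]), which yields at once the differentiability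
    of the conjugate at w and the value p of its gradient.

    The three-point identity for the Bregman distance D then turns the
    inequalities defining the two level proximal subdifferentials into those
    defining the two proximal mappings ([level_prox], [right_level_prox]):
    this is (a) with (b), and (c) with (d).

    For (b), (d) and (e), the inequalities
    [env y <= hull x + D x y / lambda <= f x + D x y / lambda] hold for all x
    in X and y in Y, and x is in the left prox of y exactly when both are
    equalities. A minimizer y of the right proximal problem at x only gives
    the first equality; that x admits some level subgradient provides another
    point y' at which both are equalities, hence contact of the hull with f at
    x ([right_prox_left_prox]).

    For (f) and (g), [lambda hull + phi] is a supremum of affine functions
    ([convex_tilted_hull]) and the convex hull of F is convex. A limiting
    subgradient of a convex function is a global one ([limiting_convex]), and
    adding phi, whose gradient is continuous on Y, shifts limiting
    subgradients by the gradient of phi ([limiting_tilt]). So in (f) or (g) a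
    convex function below F that meets F at xbar has an affine minorant of
    slope w there, which then lies below F as well. Conversely, a first-order
    expansion of phi makes a level subgradient of the hull a Fréchet
    subgradient ([level_frechet]), and an affine minorant of F touching F at
    xbar also lies below the convex hull of F ([subgradient_conv_on]). *)

Set Implicit Arguments.
Unset Strict Implicit.
Unset Printing Implicit Defensive.

Import Order.TTheory GRing.Theory Num.Theory.
Import numFieldNormedType.Exports.

Local Open Scope classical_set_scope.
Local Open Scope ring_scope.

(** * Inner products, norms and coordinates *)

Section Euclidean.
Context {R : realType} {n : nat}.
Implicit Types x y u v : 'rV[R]_n.

Lemma add_subK x y : x + y - x = y.
Proof. by rewrite addrAC subrr add0r. Qed.

Lemma segment_sub t x y : t *: x + (1 - t) *: y - y = t *: (x - y).
Proof. by rewrite scalerBl scale1r scalerBr addrCA addrAC subrr add0r. Qed.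

Lemma dotC x y : dot x y = dot y x.
Proof. by apply: eq_bigr => i _; rewrite mulrC. Qed.

Lemma dotDr v x y : dot v (x + y) = dot v x + dot v y.
Proof. by rewrite -big_split; apply: eq_bigr => i _; rewrite mxE mulrDr. Qed.

Lemma dotZr a v x : dot v (a *: x) = a * dot v x.
Proof. by rewrite mulr_sumr; apply: eq_bigr => i _; rewrite mxE mulrCA. Qed.

Lemma dot0r v : dot v 0 = 0.
Proof. by rewrite -(scale0r 0) dotZr mul0r. Qed.

Lemma dotNr v x : dot v (- x) = - dot v x.
Proof. by rewrite -scaleN1r dotZr mulN1r. Qed.

Lemma dotBr v x y : dot v (x - y) = dot v x - dot v y.
Proof. by rewrite dotDr dotNr. Qed.

Lemma dotDl v x y : dot (x + y) v = dot x v + dot y v.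
Proof. by rewrite dotC dotDr !(dotC v). Qed.

Lemma dotZl a v x : dot (a *: x) v = a * dot x v.
Proof. by rewrite dotC dotZr dotC. Qed.

Lemma dotNl v x : dot (- x) v = - dot x v.
Proof. by rewrite dotC dotNr dotC. Qed.

Lemma dotBl v x y : dot (x - y) v = dot x v - dot y v.
Proof. by rewrite dotDl dotNl. Qed.

Definition dotE := (dotDr, dotDl, dotNr, dotNl, dotZr, dotZl).

Lemma dot_delta v i : dot v (delta_mx 0 i) = v 0 i.
Proof.
rewrite /dot (bigD1 i)//= mxE !eqxx mulr1 big1 ?addr0// => j /negPf ji.
by rewrite mxE ji andbF mulr0.
Qed.

Lemma coord_le_norm x i : `|x 0 i| <= `|x|.
Proof.
rewrite [leRHS]/Num.norm /= mx_normrE; apply/bigmax_geP; right => /=.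
by exists (0, i).
Qed.

Lemma norm_leP x (c : R) : 0 <= c -> (forall i, `|x 0 i| <= c) -> `|x| <= c.
Proof.
move=> c0 xc; rewrite [leLHS]/Num.norm /= mx_normrE; apply/bigmax_leP.
by split=> //; case=> i j _ /=; rewrite ord1.
Qed.

Lemma dot_le v x : `|dot v x| <= (\sum_i `|v 0 i|) * `|x|.
Proof.
rewrite (le_trans (ler_norm_sum _ _ _))// mulr_suml; apply: ler_sum => i _.
by rewrite normrM ler_wpM2l// coord_le_norm.
Qed.

Lemma enorm_ge0 x : 0 <= enorm x.
Proof. exact: sqrtr_ge0. Qed.

Lemma norm_le_enorm x : `|x| <= enorm x.
Proof.
apply: norm_leP => [|i]; first exact: enorm_ge0.
rewrite -sqrtr_sqr ler_wsqrtr// /dot (bigD1 i)//= expr2 lerDl.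
by apply: sumr_ge0 => j _; rewrite -expr2 sqr_ge0.
Qed.

Lemma enorm_le_sum x : enorm x <= \sum_i `|x 0 i|.
Proof.
have S0 : 0 <= \sum_i `|x 0 i| by apply: sumr_ge0.
(* the square of the right-hand side dominates the sum of squares *)
rewrite -(ger0_norm S0) -sqrtr_sqr ler_wsqrtr// expr2 /dot mulr_suml.
apply: ler_sum => i _; rewrite (le_trans (ler_norm _))// normrM ler_wpM2l//.
by rewrite (bigD1 i)//= lerDl; apply: sumr_ge0.
Qed.

Lemma enorm_le_norm x : enorm x <= n%:R * `|x|.
Proof.
rewrite (le_trans (enorm_le_sum x))//.
rewrite (le_trans (ler_sum _ (fun i _ => coord_le_norm x i)))//.
by rewrite sumr_const card_ord mulr_natl.
Qed.

Lemma cvg_coord (T : Type) (F : set_system T) (FF : Filter F)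
    (g : T -> 'rV[R]_n) v i : g @ F --> v -> (g t) 0 i @[t --> F] --> v 0 i.
Proof.
move=> gv; 
apply: (@continuous_cvg _ _ _ _ _ _ (fun x : 'rV[R]_n => x 0 i)) => //.
exact: coord_continuous.
Qed.

Lemma cvg_row (T : Type) (F : set_system T) (FF : Filter F)
    (g : T -> 'rV[R]_n) v :
  (forall i, (g t) 0 i @[t --> F] --> v 0 i) -> g @ F --> v.
Proof.
move=> gv; apply/cvgrPdist_le => e e0.
have : \forall t \near F, forall i, `|v 0 i - g t 0 i| <= e.
  by apply: filter_forall => i; move/cvgrPdist_le : (gv i); apply.
apply: filterS => t ge; apply: norm_leP => [|i]; first exact: ltW.
by rewrite !mxE.
Qed.

Lemma cvg_dot (T : Type) (F : set_system T) (FF : Filter F)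
    (g h : T -> 'rV[R]_n) u v :
  g @ F --> u -> h @ F --> v -> dot (g t) (h t) @[t --> F] --> dot u v.
Proof.
move=> gu hv; apply: cvg_big; first exact: add_continuous.
by move=> i _; apply: cvgM; exact: cvg_coord.
Qed.

Lemma dot_is_linear v : linear (dot v : 'rV[R]_n -> R^o).
Proof. by move=> a x y; rewrite dotDr dotZr. Qed.

HB.instance Definition _ v :=
  GRing.isLinear.Build R 'rV[R]_n R^o _ (dot v) (dot_is_linear v).

Lemma dot_continuous v : continuous (dot v : 'rV[R]_n -> R^o).
Proof.
move=> x; apply: (@cvg_dot _ (nbhs x) (nbhs_filter x) (cst v) id v x).
  exact: (@cvg_cst _ v _ (nbhs x) (nbhs_filter x)).
exact: cvg_id.
Qed.

End Euclidean.

(** * Gradients and first-order expansions *)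

Section Gradient.
Context {R : realType} {n : nat}.
Implicit Types (h : 'rV[R]_n -> \bar R) (x p v : 'rV[R]_n).

(** The coordinates of [grad h x] are read off the differential, which is
    linear, so pairing with [grad h x] is the differential. The statement makes
    sense even without differentiability, the differential being a total linear
    map. *)
Lemma diff_dot_grad h x v :
  ('d (fine \o h) x : 'rV[R]_n -> R^o) v = dot (grad h x) v.
Proof.
rewrite {1}(row_sum_delta v) linear_sum; apply: eq_bigr => i _.
by rewrite linearZ /= mxE mulrC.
Qed.

Lemma grad_expansion h x :
  differentiable (fine \o h : 'rV[R]_n -> R^o) x ->
  forall e : R, 0 < e -> \forall z \near x,
    `|fine (h z) - fine (h x) - dot (grad h x) (z - x)| <= e * `|z - x|.
Proof.
move=> /diff_locallyP[_ /eqaddoP dh] e e0.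
rewrite (near_shift 0 x) subr0 /=; near=> z.
rewrite /= addrK -diff_dot_grad.
have : `|(fine \o h \o shift x - (cst ((fine \o h) x) +
  'd (fine \o h : 'rV[R]_n -> R^o) x)) z| <= e * `|z|.
  by near: z; exact: dh.
by rewrite /= !fctE /= opprD addrA.
Unshelve. all: by end_near. Qed.

(** A first-order expansion determines the differential, so exhibiting one is
    how a gradient gets computed. *)
Lemma grad_unique h x p :
  (forall e : R, 0 < e -> \forall z \near x,
    `|fine (h z) - fine (h x) - dot p (z - x)| <= e * `|z - x|) ->
  grad h x = p.
Proof.
move=> hp; apply/rowP => i; rewrite mxE.
rewrite (@diff_unique _ _ _ _ (dot p : {linear 'rV[R]_n -> R^o})).
- exact: dot_delta.
- exact: dot_continuous.
apply/eqaddoP => e e0; have := hp e e0.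
rewrite (near_shift 0 x) subr0 /=; apply: filterS => z.
by rewrite /= addrK !fctE /= opprD addrA.
Qed.

End Gradient.

(** * Fréchet subgradients of convex functions *)

Section Frechet.
Context {R : realType} {n : nat}.
Implicit Types (h : 'rV[R]_n -> \bar R) (A : set 'rV[R]_n) (x v : 'rV[R]_n).

(** Clearing the denominator of the difference quotient gives an inequality
    that can be added and scaled. The sup norm replaces the Euclidean one, the
    two being equivalent and [e] arbitrary. *)
Lemma frechetP A h x v : frechet_subdiff A h x v <->
  [/\ A x, h x \is a fin_num & forall e : R, 0 < e -> \forall z \near x, A z ->
    (h x + (dot v (z - x) - e * `|z - x|)%:E <= h z)%E].
Proof.
split=> -[Ax hx H]; split=> //.
  move=> e e0; rewrite limf_einfE in H.
  (* [n.+1] rather than [n], so that the division makes sense when [n = 0] *)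
  set e' := e / n.+1%:R.
  have e'0 : 0 < e' by rewrite divr_gt0.
  have e'N : ((- e')%:E < 0)%E by rewrite lte_fin oppr_lt0.
  have /ereal_sup_gt[_ [V xV <-] Ve] := lt_le_trans e'N H.
  have {}xV : nbhs x [set z | z != x -> A z -> V z] := xV.
  apply: filterS xV => z zV Az.
  have [->|zx] := eqVneq z x.
    by rewrite subrr normr0 mulr0 subr0 dot0r adde0.
  have := lt_le_trans Ve (ereal_inf_lbound (imageP _ (zV zx Az))).
  have N0 : 0 < enorm (z - x).
    by rewrite (lt_le_trans _ (norm_le_enorm _))// normr_gt0 subr_eq0.
  have en : e' * enorm (z - x) <= e * `|z - x|.
    rewrite /e' -mulrA ler_wpM2l ?(ltW e0)// ler_pdivrMl//.
    by rewrite (le_trans (enorm_le_norm _))// ler_wpM2r// ler_nat.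
  move: (h x) hx => [r| |]//= _; case: (h z) => [s| |]/=.
  - by rewrite -!EFinD -EFinM lte_fin lee_fin ltr_pdivlMr// => He; lra.
  - by rewrite leey.
  - by rewrite mulNyr gtr0_sg ?invr_gt0// mul1e.
rewrite limf_einfE; apply/lee_subgt0Pr => e e0; rewrite sub0e.
pose V := [set z | z != x /\ A z /\
  (h x + (dot v (z - x) - e * `|z - x|)%:E <= h z)%E].
have xV : within A (dnbhs x) V.
  have : nbhs x [set z | z != x -> A z -> V z].
    by apply: filterS (H e e0) => z zV zx Az; split=> //; split=> //; exact: zV.
  by [].
apply: le_trans (ereal_sup_ubound (imageP _ xV)).
apply: le_ereal_inf_tmp => _ [z [zx [Az zh]] <-].
have N0 : 0 < enorm (z - x).
  by rewrite (lt_le_trans _ (norm_le_enorm _))// normr_gt0 subr_eq0.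
have en := ler_wpM2l (ltW e0) (norm_le_enorm (z - x)).
move: (h x) hx zh => [r| |]//= _; case: (h z) => [s| |]//=.
- by rewrite -!EFinD -EFinM !lee_fin ler_pdivlMr// => He; lra.
- by move=> _; rewrite mulyr gtr0_sg ?invr_gt0// mul1e leey.
Qed.

Lemma limiting_frechet A h x v :
  frechet_subdiff A h x v -> limiting_subdiff A h x v.
Proof.
move=> hv; have [Ax hx _] := hv; split=> //; first by rewrite ltey_eq hx.
by exists (fun=> x), (fun=> v); split=> //; exact: cvg_cst.
Qed.

Lemma near_segment (U : set 'rV[R]_n) x d : nbhs x U ->
  exists t : R, [/\ 0 < t, t < 1 & U (x + t *: d)].
Proof.
move=> xU.
have xd : x + t *: d @[t --> 0^'+] --> x.
  rewrite -[X in _ --> X]addr0 -(scale0r d); apply: cvgD; first exact: cvg_cst.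
  apply: cvgZ; last exact: cvg_cst.
  by apply: cvg_at_right_filter; exact: cvg_id.
have /(@filter_ex _ _ (at_right_proper_filter 0))[t [t0 [t1 Ut]]] :
    \forall t \near (0 : R)^'+, 0 < t /\ (t < 1 /\ U (x + t *: d)).
  apply: filterI; first exact: nbhs_right_gt.
  by apply: filterI; [exact: nbhs_right_lt | exact: xd].
by exists t.
Qed.

(** [convex_on A] constrains only the values at points of segments; subgradient
    arguments also need the segments to stay in [A]. *)
Definition cvx_dom A := forall x y (t : R), A x -> A y -> 0 < t < 1 ->
  A (t *: x + (1 - t) *: y).

(** A small step from [x] towards [z] costs at most [e] per unit length by the
    Fréchet inequality, and convexity bounds [h] at that step by the chord to
    [z]; dividing by the step size turns local information into a global
    inequality. *)
Lemma frechet_convex A h x v : cvx_dom A -> convex_on A h ->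
  frechet_subdiff A h x v ->
  forall z, A z -> (h x + (dot v (z - x))%:E <= h z)%E.
Proof.
move=> cA ch /frechetP[Ax hx H] z Az.
move: (hx) => /fineK; set r := fine (h x) => hr.
(* Testing against real upper bounds of [h z] covers its infinite values too. *)
suff Hs s : (h z <= s%:E)%E -> r + dot v (z - x) <= s.
  rewrite -hr -EFinD; case hz : (h z) Hs => [s| |] Hs.
  - by rewrite lee_fin Hs.
  - exact: leey.
  - have := Hs (r + dot v (z - x) - 1).
    by rewrite leNye lerDl oppr_ge0 ler10 => /(_ isT).
move=> hzs; set d := z - x.
apply/ler_addgt0Pr => e e0.
have d0 : 0 < `|d| + 1 by rewrite ltr_wpDl.
have e'0 : 0 < e / (`|d| + 1) by rewrite divr_gt0.
have [t [t0 t1 Ht]] := near_segment d (H _ e'0).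
have xt : x + t *: d = t *: z + (1 - t) *: x.
  by rewrite -segment_sub addrC subrK.
have t01 : 0 < t < 1 by rewrite t0.
have At : A (x + t *: d) by rewrite xt; exact: cA.
have := Ht At; rewrite add_subK normrZ (gtr0_norm t0) dotZr.
have : (h (x + t *: d)%R <= (t * s + (1 - t) * r)%:E)%E.
  rewrite xt; apply: (le_trans (ch _ _ _ Az Ax t01)).
  rewrite -hr; case: (h z) hzs => [q| |]//=.
  - by rewrite !lee_fin lerD2r ler_pM2l.
  - by move=> _; rewrite mulrNy gtr0_sg// mul1e -EFinM /= leNye.
move=> /[swap] /le_trans /[apply]; rewrite -hr -EFinD lee_fin.
have : e / (`|d| + 1) * (t * `|d|) <= t * e.
  rewrite mulrCA ler_pM2l// -mulrA ler_piMr ?(ltW e0)// ler_pdivrMl//.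
  by rewrite mulr1 lerDl.
move=> h1 h2; rewrite -(ler_pM2l t0); clear hr; lra.
Qed.

(** Affine minorants survive limits of their base points, values and slopes. *)
Lemma cvg_affine_le (r_ : nat -> R) (x_ v_ : nat -> 'rV[R]_n) r x v z s :
  r_ @ \oo --> r -> x_ @ \oo --> x -> v_ @ \oo --> v ->
  (\forall k \near \oo, r_ k + dot (v_ k) (z - x_ k) <= s) ->
  r + dot v (z - x) <= s.
Proof.
move=> rr xx vv H.
have : r_ k + dot (v_ k) (z - x_ k) @[k --> \oo] --> r + dot v (z - x).
  by apply: cvgD => //; apply: cvg_dot => //; apply: cvgB => //; exact: cvg_cst.
by move=> /cvgr_to_le; apply.
Qed.

End Frechet.

(** * Distance-generating functions on the interior of their domain *)

Section DistanceGenerating.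
Context {R : realType} {n : nat} {phi : 'rV[R]_n -> \bar R}.
Context (phi_dgf : dgf phi).
Implicit Types (x y z d w p : 'rV[R]_n).

Local Notation X := (edom phi).
Local Notation Y := (edom phi)°.
Local Notation P x := (fine (phi x)).

Lemma int_dom x : Y x -> X x.
Proof. exact: interior_subset. Qed.

Lemma nbhs_int_dom x : Y x -> nbhs x Y.
Proof.
by move=> Yx; apply: open_nbhs_nbhs; split=> //; exact: open_interior.
Qed.

Lemma dom_fin_num x : X x -> phi x \is a fin_num.
Proof.
have [[_ phiNy] _ _ _ _] := phi_dgf => Xx.
by rewrite fin_numElt Xx phiNy.
Qed.

Lemma dom_fineK x : X x -> phi x = (P x)%:E.
Proof. by move=> Xx; rewrite fineK// dom_fin_num. Qed.

Lemma dgf_convex_fine x y t : X x -> X y -> 0 < t < 1 ->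
  X (t *: x + (1 - t) *: y) /\
  P (t *: x + (1 - t) *: y) <= t * P x + (1 - t) * P y.
Proof.
have [_ _ cphi _ _] := phi_dgf => Xx Xy t01.
have := cphi x y t I I t01; rewrite (dom_fineK Xx) (dom_fineK Xy) /= => le.
have Xt : X (t *: x + (1 - t) *: y) by exact: le_lt_trans le (ltry _).
by split=> //; move: le; rewrite (dom_fineK Xt) lee_fin.
Qed.

Lemma cvx_dom_dgf : cvx_dom X.
Proof. by move=> x y t Xx Xy /(dgf_convex_fine Xx Xy)[]. Qed.

Lemma dgf_expansion y : Y y -> forall e : R, 0 < e -> \forall z \near y,
  `|P z - P y - dot (grad phi y) (z - y)| <= e * `|z - y|.
Proof. by have [_ _ _ _ dphi] := phi_dgf => /dphi; exact: grad_expansion. Qed.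

Lemma dgf_continuous y : Y y -> {for y, continuous (fine \o phi)}.
Proof.
by have [_ _ _ _ dphi] := phi_dgf => /dphi /differentiable_continuous.
Qed.

Lemma grad_frechet y : Y y -> frechet_subdiff setT phi y (grad phi y).
Proof.
move=> Yy; apply/frechetP; split=> //; first exact: dom_fin_num (int_dom Yy).
move=> e e0; have := nbhs_int_dom Yy.
apply: filterS2 (dgf_expansion Yy e0) => z + Yz _.
rewrite (dom_fineK (int_dom Yz)) (dom_fineK (int_dom Yy)) lee_fin.
by rewrite ler_norml => /andP[+ _]; lra.
Qed.

(** The gradient is a Fréchet subgradient of a convex function, hence a global
    one. *)
Lemma grad_ineq y z : Y y -> X z -> P y + dot (grad phi y) (z - y) <= P z.
Proof.
move=> Yy Xz; have [_ _ cphi _ _] := phi_dgf.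
have := frechet_convex (fun _ _ _ _ _ _ => I) cphi (grad_frechet Yy)
  (I : setT z).
by rewrite (dom_fineK Xz) (dom_fineK (int_dom Yy)) lee_fin.
Qed.

(** By [grad_ineq] the function [phi] rises along [d] at least at the rate
    [dot (grad phi y) d]; differentiability makes it rise hardly faster over a
    small enough step. *)
Lemma directional_upper y d (e : R) : Y y -> 0 < e ->
  exists t : R, [/\ 0 < t, Y (y + t *: d) &
    P (y + t *: d) <= P y + t * (dot (grad phi y) d + e * `|d|)].
Proof.
move=> Yy e0.
have [t [t0 _ [Yt Ht]]] :=
  near_segment d (filterI (nbhs_int_dom Yy) (dgf_expansion Yy e0)).
exists t; split=> //; move: Ht => /=.
by rewrite add_subK dotZr normrZ gtr0_norm// ler_norml => /andP[_]; lra.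
Qed.

Lemma dot_le_eq v w : (forall d, dot v d <= dot w d) -> v = w.
Proof.
move=> vw; apply/rowP => i; apply/le_anti; rewrite -!dot_delta vw /=.
by have := vw (- delta_mx 0 i); rewrite !dotNr lerN2.
Qed.

(** Differentiability leaves room for a single subgradient. *)
Lemma subgrad_grad y w : Y y -> (forall z, X z -> P y + dot w (z - y) <= P z) ->
  grad phi y = w.
Proof.
move=> Yy wy; apply/esym/dot_le_eq => d; apply/ler_addgt0Pr => e e0.
have d0 : 0 < `|d| + 1 by rewrite ltr_wpDl.
have [t [t0 Yt Pt]] := directional_upper d Yy (divr_gt0 e0 d0).
have := le_trans (wy _ (int_dom Yt)) Pt.
rewrite add_subK dotZr lerD2l ler_pM2l// => /le_trans; apply.
rewrite lerD2l -mulrA ler_piMr ?(ltW e0)// ler_pdivrMl//.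
by rewrite mulr1 lerDl.
Qed.

(** A convex function that is differentiable is continuously differentiable.
    With a step [t] chosen at [y], the slope at [z] along [c] is at most the
    difference quotient of [phi] between [z] and [z + t *: c], which is
    continuous in [z] and at [z = y] close to the slope there; [- c] gives the
    other bound. *)
Lemma grad_dot_continuous y d : Y y ->
  {for y, continuous (fun z => dot (grad phi z) d)}.
Proof.
have := grad_ineq; have := directional_upper.
move: (grad phi) => g dir_upper ineq.
have upper (c : 'rV[R]_n) (e : R) : Y y -> 0 < e ->
    \forall z \near y, dot (g z) c <= dot (g y) c + e.
  move=> Yy e0.
  have c0 : 0 < `|c| + 1 by rewrite ltr_wpDl.
  have e20 : 0 < e / 2 by rewrite divr_gt0.
  have [t [t0 Yt Pt]] := dir_upper _ c _ Yy (divr_gt0 e20 c0).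
  have ce : e / 2 / (`|c| + 1) * `|c| <= e / 2.
    rewrite -mulrA ler_piMr ?(ltW e20)// ler_pdivrMl//.
    by rewrite mulr1 lerDl.
  have te : 0 < t * (e / 2) by rewrite mulr_gt0.
  have shift : {for y, continuous (fun z => z + t *: c)}.
    apply: (@cvgD _ _ _ (nbhs y) (nbhs_filter y) id (cst (t *: c))).
      exact: cvg_id.
    exact: (@cvg_cst _ (t *: c) _ (nbhs y) (nbhs_filter y)).
  have lim : P (z + t *: c) - P z @[z --> y] --> P (y + t *: c) - P y.
    apply: (@cvgB _ _ _ (nbhs y) (nbhs_filter y) (fun z => P (z + t *: c))
      (fun z => P z)); last exact: dgf_continuous.
    exact: (continuous_comp shift (dgf_continuous Yt)).
  have near_lt : \forall z \near y,
      P (z + t *: c) - P z < P (y + t *: c) - P y + t * (e / 2).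
    have := @cvgr_lt _ _ _ (nbhs_filter y) _ _ lim
      (P (y + t *: c) - P y + t * (e / 2)).
    by rewrite ltrDl => /(_ te).
  have near_dom : nbhs y [set z | Y (z + t *: c)] := shift _ (nbhs_int_dom Yt).
  have near_Y : nbhs y Y := nbhs_int_dom Yy.
  have key (z : 'rV[R]_n) :
      P (z + t *: c) - P z < P (y + t *: c) - P y + t * (e / 2) ->
      Y (z + t *: c) -> Y z -> dot (g z) c <= dot (g y) c + e.
    move=> ltz Ytz Yz.
    have gz := ineq _ _ Yz (int_dom Ytz).
    rewrite add_subK dotZr in gz; rewrite -(ler_pM2l t0).
    by move: gz ltz (ler_wpM2l (ltW t0) ce) Pt; clear; lra.
  apply: filterS (filterI near_lt (filterI near_dom near_Y)) => z [lt_z [? ?]].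
  exact: key.
move=> Yy; apply/(@cvgrPdist_le _ _ _ _ (nbhs_filter y)) => e e0.
apply: (@filterS2 _ _ (nbhs_filter y) _ _ _ _ (upper d e Yy e0)
  (upper (- d) e Yy e0)) => z.
by rewrite !dotNr ler_norml; lra.
Qed.

Lemma grad_continuous y : Y y -> {for y, continuous (grad phi)}.
Proof.
move=> Yy; have dot_cont d := grad_dot_continuous (d := d) Yy.
move: (grad phi) dot_cont => g dot_cont.
apply: (@cvg_row _ _ _ _ (nbhs_filter y)) => i.
have coordE : (fun z => dot (g z) (delta_mx 0 i)) = (fun z => g z 0 i).
  by apply/funext => z; exact: dot_delta.
by have := dot_cont (delta_mx 0 i); rewrite coordE.
Qed.

End DistanceGenerating.

(** * Existence of subgradients under 1-coercivity *)

(** The sublevel sets of [h] at points of [K] form a filter basis; a cluster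
    point lies below all of them because [h] is lower semicontinuous. *)
Lemma lsc_compact_min (R : realType) (T : topologicalType) (K : set T)
    (h : T -> \bar R) : compact K -> K !=set0 -> lower_semicontinuous h ->
  exists2 p, K p & forall x, K x -> (h p <= h x)%E.
Proof.
move=> cK [x0 Kx0] lsch.
pose level x := [set y | K y /\ (h y <= h x)%E].
pose F := filter_from K level.
have FF : ProperFilter F.
  apply: filter_from_proper; last by move=> x Kx; exists x; split.
  apply: filter_from_filter; first by exists x0.
  move=> x y Kx Ky; have [xy|/ltW yx] := leP (h x) (h y).
    by exists x => // z [Kz zx]; split; split=> //; exact: le_trans zx xy.
  by exists y => // z [Kz zy]; split; split=> //; exact: le_trans zy yx.
have FK : F K by exists x0 => // z [].
have [p [Kp Fp]] := cK F FF FK; exists p => // x Kx.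
rewrite leNgt; apply/negP => hxp.
have [a hxa ahp] : exists2 a : R, (h x <= a%:E)%E & (a%:E < h p)%E.
  move: hxp; case: (h x) => [r| |]; case: (h p) => [s| |] //=.
  - by exists r.
  - by exists r.
  - by exists (s - 1); rewrite ?leNye// lte_fin ltrBlDr ltrDl.
  - by exists 0; rewrite ?leNye// ltry.
have [V pV Va] := lsch p a ahp.
have Flevel : F (level x) by exists x.
have [y [[_ hyx] /Va]] := Fp _ _ Flevel pV.
by rewrite ltNge (le_trans hyx hxa).
Qed.

Section Conjugacy.
Context {R : realType} {n : nat} {phi : 'rV[R]_n -> \bar R}.
Context (phi_dgf : dgf phi).
Implicit Types (x y z d w p : 'rV[R]_n).

Local Notation X := (edom phi).
Local Notation Y := (edom phi)°.
Local Notation P x := (fine (phi x)).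

Lemma coercive_growth (M : R) : one_coercive phi ->
  exists K : R, forall x, X x -> K < enorm x -> M * enorm x <= P x.
Proof.
rewrite /one_coercive limf_einfE => coer.
have M_lt : (M%:E < +oo)%E by exact: ltry.
rewrite -coer in M_lt.
have [_ [V [K _ KV] <-] MV] := ereal_sup_gt M_lt.
exists (Num.max K 0) => x Xx; rewrite gt_max => /andP[Kx x0].
have := lt_le_trans MV (ereal_inf_lbound (imageP _ (KV x Kx))).
by rewrite (dom_fineK phi_dgf Xx) -EFinM lte_fin ltr_pdivlMr// => /ltW.
Qed.

Lemma lsc_tilt w : lower_semicontinuous phi ->
  lower_semicontinuous (fun x => phi x - (dot w x)%:E)%E.
Proof.
move=> lphi x a ahx.
have [b ab bphi] : exists2 b : R, a + dot w x < b & (b%:E < phi x)%E.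
  move: ahx; case: (phi x) => [r| |]//.
    rewrite -EFinB lte_fin ltrBrDr => h.
    exists ((a + dot w x + r) / 2); rewrite ?lte_fin; lra.
  by exists (a + dot w x + 1); rewrite ?ltry// ltrDl.
have [V xV bV] := lphi x b bphi.
exists (V `&` [set y | dot w y < b - a]).
  apply: filterI => //.
  have := @cvgr_lt _ _ _ (nbhs_filter x) _ _
    (dot_continuous (v := w) (x := x)) (b - a).
  by apply; rewrite ltrBrDl.
move=> y [/bV by_ /= wy]; case: (phi y) by_ => [r| |]//.
  by rewrite -EFinB !lte_fin; lra.
by move=> _; exact: ltry.
Qed.

(** Every [w] is a subgradient of [phi] somewhere: [phi - dot w] attains its
    minimum, since 1-coercivity confines the search to a compact ball. *)
Lemma subgradient_exists w : one_coercive phi ->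
  exists2 p, X p & forall x, X x -> P p + dot w (x - p) <= P x.
Proof.
move=> coer; have [_ lphi _ [x0 /int_dom Xx0] _] := phi_dgf.
(* Outside a ball of radius [M], [phi] outgrows [dot w] and its value at [x0]. *)
pose S := \sum_i `|w 0 i|.
have [K HK] := coercive_growth (S + 1) coer.
pose M := Num.max (Num.max K (P x0 - dot w x0)) `|x0|.
pose B := [set x : 'rV[R]_n | `|x| <= M].
have Bx0 : B x0 by rewrite /B /= /M le_max lexx orbT.
have cB : compact B.
  apply: bounded_closed_compact.
    by exists M; split=> [|z Mz x /= xM]; rewrite ?num_real// (le_trans xM)// ltW.
  have -> : B = (fun x => `|x|) @^-1` [set r : R | r <= M] by [].
  by apply: closed_comp; [move=> ? _; exact: norm_continuous | exact: closed_le].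
have [p Bp minp] :=
  lsc_compact_min cB (ex_intro _ x0 Bx0) (lsc_tilt (w := w) lphi).
have := minp _ Bx0; rewrite (dom_fineK phi_dgf Xx0) => px0.
have Xp : X p.
  by rewrite /edom /= ltNge leye_eq; apply: contraL px0 => /eqP ->.
exists p => // x Xx; rewrite dotBr.
have [Bx|] := boolP (`|x| <= M).
  have := minp _ Bx; rewrite (dom_fineK phi_dgf Xp) (dom_fineK phi_dgf Xx).
  by rewrite -!EFinB lee_fin; lra.
rewrite -ltNge /M !gt_max => /andP[/andP[Kx x0x] _].
move: px0; rewrite (dom_fineK phi_dgf Xp) -!EFinB lee_fin => px0.
have := HK _ Xx (lt_le_trans Kx (norm_le_enorm _)).
have := dot_le w x; rewrite -/S ler_norml => /andP[_ dotle].
have S0 : 0 <= S by apply: sumr_ge0.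
have := ler_wpM2l S0 (norm_le_enorm x).
have := norm_le_enorm x.
lra.
Qed.

(** The homothety centred at [p] that sends [x] to the given point carries a
    neighbourhood of [x] inside the domain to a neighbourhood of that point. *)
Lemma int_dom_segment x p t : Y x -> X p -> 0 < t < 1 ->
  Y (t *: x + (1 - t) *: p).
Proof.
move=> Yx Xp t01; have /andP[t0 t1] := t01.
pose back z := t^-1 *: (z - (1 - t) *: p).
have back_cont : {for t *: x + (1 - t) *: p, continuous back}.
  move=> /=; apply: (@cvgZl_tmp _ _ _ _ (nbhs_filter _)).
  apply: (@cvgB _ _ _ (nbhs _) (nbhs_filter _) id (cst _)).
    exact: cvg_id.
  exact: (@cvg_cst _ _ _ (nbhs _) (nbhs_filter _)).
have backx : back (t *: x + (1 - t) *: p) = x.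
  by rewrite /back addrK scalerA mulVf ?gt_eqF// scale1r.
have : nbhs (t *: x + (1 - t) *: p) (back @^-1` Y).
  by apply: back_cont; rewrite backx; exact: nbhs_int_dom.
apply: filterS => z /int_dom Xz.
have -> : z = t *: back z + (1 - t) *: p.
  by rewrite /back scalerA divff ?gt_eqF// scale1r subrK.
exact: cvx_dom_dgf.
Qed.

End Conjugacy.

(** * Inverting the gradient of a Legendre function *)

Section Legendre.
Context {R : realType} {n : nat} {phi : 'rV[R]_n -> \bar R}.
Context (phi_dgf : dgf phi).
Implicit Types (x y z d w p v : 'rV[R]_n).

Local Notation X := (edom phi).
Local Notation Y := (edom phi)°.
Local Notation P x := (fine (phi x)).

(** A boundary point carries no subgradient when [phi] is essentially smooth.
    Approaching such a point along a segment from the interior, gradients would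
    blow up; but a subgradient at the end point, with monotonicity, keeps them
    bounded in every direction. *)
Lemma subgradient_interior w p : essentially_smooth phi -> X p ->
  (forall x, X x -> P p + dot w (x - p) <= P x) -> Y p.
Proof.
move=> [[x0 Yx0] _ blowup] Xp wp; apply: contrapT => nYp.
pose s k : R := harmonic k / 2.
have s01 k : 0 < s k < 1.
  rewrite divr_gt0 ?harmonic_gt0//= ltr_pdivrMr// mul1r.
  by rewrite (@le_lt_trans _ _ 1) ?ltr1n// invf_le1// ler1n.
pose x_ k := s k *: x0 + (1 - s k) *: p.
have Yx_ k : Y (x_ k) by exact: int_dom_segment.
have x_p k : x_ k - p = s k *: (x0 - p). by exact: segment_sub.
have x_cvg : x_ @ \oo --> p.
  have -> : x_ = (fun k => s k *: (x0 - p) + p).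
    by apply/funext => k; rewrite -x_p subrK.
  rewrite -[X in _ --> X]add0r -(scale0r (x0 - p)).
  apply: cvgD; last exact: cvg_cst.
  apply: cvgZr_tmp; rewrite -(mul0r 2^-1).
  by apply: cvgM; [exact: cvg_harmonic | exact: cvg_cst].
have bdp : (closure X `\` Y) p by split=> //; exact: subset_closure.
move: blowup => /(_ x_ p Yx_ bdp x_cvg).
have := grad_ineq phi_dgf; move: (grad phi) => g ineq blowup.
(* Both [wp] and the gradient inequality at [x_ k] control the component along
   [x0 - p]; a point [x0 + t *: d] of the domain then controls that along [d]. *)
have bounded d : exists C, forall k, dot (g (x_ k)) d <= C.
  have [t [t0 _ /int_dom Xt]] := near_segment d (nbhs_int_dom Yx0).
  exists ((P (x0 + t *: d) - P p - dot w (x0 - p)) / t) => k.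
  have /andP[s0 s1] := s01 k.
  have h1 := ineq _ _ (Yx_ k) Xp.
  have h2 := wp _ (int_dom (Yx_ k)).
  have h3 := ineq _ _ (Yx_ k) Xt.
  have e1 : p - x_ k = - (s k *: (x0 - p)) by rewrite -x_p opprB.
  have e3 : x0 + t *: d - x_ k = (1 - s k) *: (x0 - p) + t *: d.
    by rewrite scalerBl scale1r -x_p opprB subrKA addrAC.
  rewrite x_p dotZr in h2; rewrite e1 dotNr dotZr in h1.
  rewrite e3 dotDr !dotZr in h3.
  have ab : dot w (x0 - p) <= dot (g (x_ k)) (x0 - p).
    by rewrite -(ler_pM2l s0); lra.
  have s1' : 0 <= 1 - s k by lra.
  have := ler_wpM2l s1' ab.
  by rewrite ler_pdivlMr//; lra.
have /choice[C HC] : forall i, exists C, forall k, `|g (x_ k) 0 i| <= C.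
  move=> i; have [C1 h1] := bounded (delta_mx 0 i).
  have [C2 h2] := bounded (- delta_mx 0 i).
  exists (Num.max C1 C2) => k.
  have := h1 k; have := h2 k; rewrite dotNr dot_delta => a b.
  by rewrite ler_norml lerNl !le_max a b orbT.
have /cvgryPgt/(_ (\sum_i C i)) := blowup.
move=> /(@filter_ex _ _ _)[k]; apply/negP; rewrite -leNgt.
apply: le_trans (enorm_le_sum _) _; apply: ler_sum => i _; exact: HC.
Qed.

(** Strict convexity applies on [Y], where gradients provide the required
    subgradients. *)
Lemma strict_subgradient w p x : essentially_strictly_convex phi ->
  (forall x, X x -> P p + dot w (x - p) <= P x) ->
  Y p -> Y x -> x != p -> P p + dot w (x - p) < P x.
Proof.
move=> esc wp Yp Yx xp.
have Ycvx : convex_set (Y : set (convex_lmodType 'rV[R]_n)).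
  apply/convex_setW => y z; rewrite !inE => Yy Yz k k0 k1; rewrite inE.
  by apply: (int_dom_segment phi_dgf Yy (int_dom Yz)); rewrite k0.
have Ydom : Y `<=` set_dom (limiting_subdiff setT phi).
  by move=> y Yy; exists (grad phi y); apply/limiting_frechet/grad_frechet.
(* A tie at [x] would make the strict inequality at the midpoint beat [wp]. *)
have half : 0 < (1 / 2 : R) < 1 by lra.
have := esc Y Ycvx Ydom x p (1 / 2) Yx Yp xp half.
have Ym := int_dom_segment phi_dgf Yx (int_dom Yp) half.
have := wp _ (int_dom Ym).
rewrite (dom_fineK phi_dgf (int_dom Ym)) (dom_fineK phi_dgf (int_dom Yx)).
rewrite (dom_fineK phi_dgf (int_dom Yp)) -!EFinM -EFinD lte_fin.
by rewrite segment_sub dotZr; lra.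
Qed.

(** The gap between [phi] and its affine minorant at [p] has a positive minimum
    on a small sphere around [p], by compactness and [strict_subgradient], and
    convexity propagates it outwards linearly. This quantitative form of
    uniqueness of the minimizer is what makes the conjugate differentiable. *)
Lemma subgradient_growth w p (e : R) : essentially_strictly_convex phi ->
  (forall x, X x -> P p + dot w (x - p) <= P x) -> Y p -> 0 < e ->
  exists2 delta : R, 0 < delta & forall x, X x -> e <= `|x - p| ->
    P p + dot w (x - p) + delta * `|x - p| <= P x.
Proof.
move=> esc wp Yp e0.
have [r0 /= r00 rY] := (iffLR (nbhs_ballP _ _)) (nbhs_int_dom Yp).
pose r := Num.min e (r0 / 2).
have r_gt0 : 0 < r by rewrite lt_min e0 divr_gt0.
have rr0 : r < r0 by rewrite gt_min ltr_pdivrMr// ltr_pMr// ltr1n orbT.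
pose S := [set x | `|x - p| = r].
have SY x : S x -> Y x.
  by move=> Sx; apply: rY; rewrite -ball_normE /ball_ /= distrC Sx.
(* the gap between [phi] and its affine minorant *)
pose q x := P x - P p - dot w (x - p).
have cS : compact S.
  apply: bounded_closed_compact.
    exists (`|p| + r); split=> [|M Mr x /= xr]; first by rewrite num_real.
    by rewrite -(subrK p x) (le_trans (ler_normD _ _))// xr addrC ltW.
  have -> : S = (fun x => `|x - p|) @^-1` [set r] by [].
  apply: closed_comp; last exact: closed_eq.
  move=> x _; apply: (continuous_comp (f := fun x => x - p)).
    apply: (@cvgB _ _ _ (nbhs x) (nbhs_filter x) id (cst p)).
      exact: cvg_id.
    exact: (@cvg_cst _ _ _ (nbhs x) (nbhs_filter x)).
  exact: norm_continuous.
have qS : {within S, continuous q}.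
  apply: continuous_in_subspaceT => x; rewrite inE => Sx.
  apply: (@cvgB _ _ _ (nbhs x) (nbhs_filter x) (fun x => P x - P p)
    (fun x => dot w (x - p))).
    apply: (@cvgB _ _ _ (nbhs x) (nbhs_filter x) (fun x => P x) (cst (P p))).
      exact: (dgf_continuous phi_dgf (SY x Sx)).
    exact: (@cvg_cst _ _ _ (nbhs x) (nbhs_filter x)).
  have -> : (fun x => dot w (x - p)) = (fun x => dot w x - dot w p).
    by apply/funext => z; rewrite dotBr.
  rewrite dotBr.
  apply: (@cvgB _ _ _ (nbhs x) (nbhs_filter x) (dot w) (cst (dot w p))).
    exact: dot_continuous.
  exact: (@cvg_cst _ _ _ (nbhs x) (nbhs_filter x)).
(* By convexity the gap grows at least linearly along rays from [p]. *)
have ray x : X x -> e <= `|x - p| ->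
    exists2 s, S s & q s * `|x - p| <= r * q x.
  move=> Xx ex.
  have rx : r <= `|x - p| by rewrite ge_min ex.
  have N0 : 0 < `|x - p| by rewrite (lt_le_trans r_gt0).
  move: rx; rewrite le_eqVlt => /orP[/eqP rx|rx].
    by exists x => //; rewrite /S/= rx mulrC.
  pose t := r / `|x - p|.
  have t01 : 0 < t < 1 by rewrite divr_gt0//= ltr_pdivrMr// mul1r.
  have /andP[t0 _] := t01.
  exists (t *: x + (1 - t) *: p).
    by rewrite /S/= segment_sub normrZ gtr0_norm// /t divfK ?gt_eqF.
  have [_ cvx] := dgf_convex_fine phi_dgf Xx (int_dom Yp) t01.
  have -> : r * q x = t * q x * `|x - p| by rewrite /t mulrAC divfK ?gt_eqF.
  by rewrite ler_pM2r// /q segment_sub dotZr; lra.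
have [SE|/set0P S0] := eqVneq S set0.
  by exists 1 => // x Xx /(ray x Xx)[z]; rewrite SE.
have [c cS' minc] := EVT_min_rV S0 cS qS.
rewrite inE in cS'.
have qc : 0 < q c.
  have cp : c != p.
    by apply: contraPneq r_gt0 => cp; rewrite -cS' cp subrr normr0 ltxx.
  have := strict_subgradient esc wp Yp (SY _ cS') cp.
  by rewrite /q; lra.
exists (q c / r); first by rewrite divr_gt0.
move=> x Xx ex; have [s Ss] := ray x Xx ex.
have Ss' : s \in S by rewrite inE.
have := ler_wpM2r (normr_ge0 (x - p)) (minc s Ss').
move=> /le_trans /[apply].
have -> : q c / r * `|x - p| = (q c * `|x - p|) / r by rewrite mulrAC.
by rewrite -ler_pdivrMl// mulrC /q; lra.
Qed.

(** The value at [p] bounds [conjugate phi v] from below. From above, points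
    within [e / n.+1] of [p] gain at most [e * `|v - w|] over it, and for [v]
    close to [w] points farther away gain nothing because of
    [subgradient_growth]. *)
Lemma grad_conjugate w p : essentially_strictly_convex phi ->
  (forall x, X x -> P p + dot w (x - p) <= P x) -> Y p ->
  grad (conjugate phi) w = p.
Proof.
move=> esc wp Yp; apply: grad_unique => e e0.
have e1 : 0 < e / n.+1%:R by rewrite divr_gt0.
have [delta delta0 Hdelta] := subgradient_growth esc wp Yp e1.
have dn : 0 < delta / n.+1%:R by rewrite divr_gt0.
have dot_norm v x : dot v x <= n.+1%:R * `|v| * `|x|.
  rewrite (le_trans (ler_norm _))// (le_trans (dot_le _ _))// ler_wpM2r//.
  rewrite (le_trans (ler_sum _ (fun i _ => coord_le_norm v i)))//.
  by rewrite sumr_const card_ord -[leLHS]mulr_natl ler_wpM2r// ler_nat.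
have lower v : ((dot v p - P p)%:E <= conjugate phi v)%E.
  apply: ereal_sup_ubound; exists p => //.
  by rewrite (dom_fineK phi_dgf (int_dom Yp)).
have upper v : `|v - w| <= delta / n.+1%:R ->
    (conjugate phi v <= (dot v p - P p + e * `|v - w|)%:E)%E.
  move=> vw; apply: ge_ereal_sup => _ [x _ <-].
  have [Xx|nXx] := boolP (phi x < +oo)%E; last first.
    move: nXx; rewrite -leNgt leye_eq => /eqP ->.
    by rewrite /= leNye.
  rewrite (dom_fineK phi_dgf Xx) -EFinB lee_fin.
  have vx : dot v x = dot v p + dot w (x - p) + dot (v - w) (x - p).
    by rewrite dotBl !dotBr; ring.
  rewrite vx; have := dot_norm (v - w) (x - p).
  have [xe|xe] := leP (e / n.+1%:R) `|x - p|.
    have := Hdelta x Xx xe.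
    move: vw; rewrite ler_pdivlMr// mulrC => vw.
    have := ler_wpM2r (normr_ge0 (x - p)) vw.
    have := mulr_ge0 (ltW e0) (normr_ge0 (v - w)).
    lra.
  have := wp x Xx.
  move: (ltW xe); rewrite ler_pdivlMr// mulrC => xe'.
  have := ler_wpM2r (normr_ge0 (v - w)) xe'.
  lra.
have conjw : conjugate phi w = (dot w p - P p)%:E.
  apply/le_anti; rewrite lower andbT (le_trans (upper w _))//.
    by rewrite subrr normr0 ltW.
  by rewrite subrr normr0 mulr0 addr0.
have : \forall v \near w, `|v - w| <= delta / n.+1%:R.
  apply/nbhs_ballP; exists (delta / n.+1%:R) => //= v.
  by rewrite -ball_normE /ball_ /= distrC => /ltW.
apply: filterS => v vw.
have := lower v; have := upper v vw; rewrite conjw.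
case: (conjugate phi v) => [c| |]//=; rewrite !lee_fin dotBr !(dotC p) => h1 h2.
by rewrite ler_norml; lra.
Qed.

(** Each [w] is a subgradient of [phi] at some point of [Y]; there [grad phi]
    can only be [w], and the point is the gradient of the conjugate at [w]. *)
Lemma grad_conjugate_inverse w : one_coercive phi -> legendre phi ->
  Y (grad (conjugate phi) w) /\ grad phi (grad (conjugate phi) w) = w.
Proof.
move=> coer [es esc].
have [p Xp wp] := subgradient_exists phi_dgf w coer.
have Yp := subgradient_interior es Xp wp.
rewrite (grad_conjugate esc wp Yp); split=> //.
exact: subgrad_grad wp.
Qed.

End Legendre.

(** * Bregman proximal mappings, envelopes and hulls *)

Definition bregman_fine (R : realType) (n : nat) (phi : 'rV[R]_n -> \bar R)
    (x y : 'rV[R]_n) : R :=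
  fine (phi x) - fine (phi y) - dot (grad phi y) (x - y).

Section Bregman.
Context {R : realType} {n : nat} {phi : 'rV[R]_n -> \bar R}.
Context (phi_dgf : dgf phi) {lambda : R} (lambda_gt0 : 0 < lambda).
Implicit Types (x y z u v w : 'rV[R]_n) (f g h : 'rV[R]_n -> \bar R).

Local Notation X := (edom phi).
Local Notation Y := (edom phi)°.
Local Notation P x := (fine (phi x)).
Local Notation G := (grad phi).
Local Notation env := (left_env phi lambda).
Local Notation hullf := (hull phi lambda).

Local Notation D := (bregman_fine phi).

Lemma bregmanE x y : X x -> Y y -> bregman phi x y = (D x y)%:E.
Proof.
move=> Xx Yy; rewrite /bregman asboolT// (dom_fineK phi_dgf Xx).
by rewrite (dom_fineK phi_dgf (int_dom Yy)) -!EFinB.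
Qed.

Lemma three_point x y z :
  D z y = D x y + D z x + dot (G x - G y) (z - x).
Proof. by rewrite /bregman_fine; move: G => g; rewrite !dotE; ring. Qed.

Lemma lee_shift (a b : \bar R) (r s : R) :
  (a + r%:E <= b + s%:E)%E = (a + (r - s)%:E <= b)%E.
Proof.
by rewrite EFinB addeA leeBlDr.
Qed.

(** The two sides are the same inequality, and for [f] this is (a) with (b): by
    [three_point], moving the Bregman base point from [y] to [x] replaces
    [D z y - D x y] by [D z x - lambda * dot u (z - x)]. *)
Lemma level_prox h x y u : Y x -> Y y -> G y = lambda *: u + G x ->
  left_level_subdiff phi lambda h x u <-> left_prox phi lambda h y x.
Proof.
move=> Yx Yy Gy.
have key z : lambda^-1 * D x y - lambda^-1 * D z y =
    dot u (z - x) - lambda^-1 * D z x.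
  have Gxy : G x - G y = - (lambda *: u) by rewrite Gy opprD addrCA subrr addr0.
  rewrite (three_point x y z) Gxy dotNl dotZl.
  by field; rewrite gt_eqF.
split=> -[hx H]; split=> //; try exact: int_dom.
  move=> z Xz; rewrite !bregmanE//; last exact: int_dom.
  rewrite -!EFinM lee_shift key; have := H z Xz.
  by rewrite bregmanE// -EFinM -addeA -EFinB.
move=> z Xz; have := H z Xz; rewrite !bregmanE//.
by rewrite -!EFinM lee_shift key -addeA -EFinB.
Qed.

(** Again one inequality in two forms, which is (c) with (d): [three_point]
    with [y] as the middle point. *)
Lemma right_level_prox g x y : X x -> Y y ->
  right_level_subdiff phi lambda g y (lambda^-1 *: (x - y)) <->
  right_prox phi lambda g x y.
Proof.
move=> Xx Yy.
have key z : lambda^-1 * D x y - lambda^-1 * D x z =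
    dot (lambda^-1 *: (x - y)) (G z - G y) - lambda^-1 * D y z.
  rewrite (three_point y z x) dotZl; move: G => g'; rewrite !dotE !(dotC (g' _)).
  by ring.
split=> -[_ H]; split=> //.
  move=> z Yz; rewrite !bregmanE// -!EFinM lee_shift key; have := H z Yz.
  by rewrite bregmanE// -?EFinM -?addeA -?EFinB//; exact: int_dom.
move=> z Yz; have := H z Yz; rewrite !bregmanE//; last exact: int_dom.
by rewrite -!EFinM lee_shift key -addeA -EFinB.
Qed.

Lemma left_env_le f x y : X x -> Y y ->
  (env f y <= f x + (lambda^-1 * D x y)%:E)%E.
Proof.
by move=> Xx Yy; apply: ereal_inf_lbound; exists x => //; rewrite bregmanE.
Qed.

Lemma left_proxE f x y : Y y -> left_prox phi lambda f y x <->
  X x /\ env f y = (f x + (lambda^-1 * D x y)%:E)%E.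
Proof.
move=> Yy; split=> -[Xx H]; split=> //.
  apply/le_anti; rewrite left_env_le//=.
  apply: le_ereal_inf_tmp => _ [z Xz <-].
  by have := H z Xz; rewrite [bregman phi x y]bregmanE// -EFinM.
move=> z Xz; rewrite !bregmanE// -!EFinM -H; exact: left_env_le.
Qed.

Lemma left_env_lty f y : proper_on X f -> Y y -> (env f y < +oo)%E.
Proof.
move=> [[x Xx fx] _] Yy; apply: le_lt_trans (left_env_le f Xx Yy) _.
by case: (f x) fx => [r| |]//= _; rewrite ltry.
Qed.

Lemma left_prox_fin_num f x y : proper_on X f -> Y y ->
  left_prox phi lambda f y x -> f x \is a fin_num.
Proof.
move=> fp Yy /left_proxE-/(_ Yy)[Xx envE].
have := left_env_lty fp Yy; rewrite envE.
by have := fp.2 x Xx; case: (f x).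
Qed.

(** If [x] attains the envelope at [y], then [- env y + D x y / lambda] equals
    [- f x], which bounds all the competing values from below because
    [env z <= f x + D x z / lambda]. *)
Lemma left_prox_right_prox f x y : proper_on X f -> Y y ->
  left_prox phi lambda f y x ->
  right_prox phi lambda (fun y => - env f y)%E x y.
Proof.
move=> fp Yy px; have fx := left_prox_fin_num fp Yy px.
have [Xx envE] := (left_proxE f x Yy).1 px.
split=> // z Yz; have := left_env_le f Xx Yz.
rewrite !bregmanE// envE -!EFinM.
case: (f x) fx => [r| |]// _; case: (env f z) => [s| |]//.
- by rewrite -!EFinD !lee_fin; lra.
- by move=> _; exact: leey.
Qed.

(** The extra point [y'] certifies that the right envelope takes the value
    [- f x] at [x]; the minimizer [y] must then reach it too. *)
Lemma right_prox_left_prox f x y y' : proper_on X f -> Y y -> Y y' ->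
  left_prox phi lambda f y' x ->
  right_prox phi lambda (fun y => - env f y)%E x y ->
  left_prox phi lambda f y x.
Proof.
move=> fp Yy Yy' px' [_ H]; have fx := left_prox_fin_num fp Yy' px'.
have [Xx envE] := (left_proxE f x Yy').1 px'.
apply/(left_proxE f x Yy); split=> //; apply/le_anti; rewrite left_env_le//=.
have := H y' Yy'; rewrite !bregmanE// envE -!EFinM.
case: (f x) fx => [r| |]// _; case: (env f y) => [s| |]//.
- by rewrite -!EFinD !lee_fin; lra.
- by move=> _; exact: leey.
Qed.

Lemma hull_leP f x (c : \bar R) : X x ->
  (forall y, Y y -> env f y <= c + (lambda^-1 * D x y)%:E)%E ->
  (hullf f x <= c)%E.
Proof.
move=> Xx H; rewrite /hull leeNl; apply: le_ereal_inf_tmp => _ [y Yy <-].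
rewrite bregmanE// -EFinM; have := H y Yy.
case: c {H} => [r| |]; case: (env f y) => [s| |]//=; rewrite ?leey ?leNye//.
by rewrite -!EFinD !lee_fin; lra.
Qed.

(** The hull is the least function above all the functions
    [env y - D x y / lambda] of [x]; as [f] is another one, the hull lies below
    [f] ([hull_le]). *)
Lemma left_env_le_hull f x y : X x -> Y y ->
  (env f y <= hullf f x + (lambda^-1 * D x y)%:E)%E.
Proof.
move=> Xx Yy.
have : (right_env phi lambda (fun y => - env f y) x <=
    - env f y + (lambda^-1 * D x y)%:E)%E.
  by apply: ereal_inf_lbound; exists y => //; rewrite bregmanE.
rewrite /hull.
case: (right_env _ _ _ _) => [r| |]; case: (env f y) => [s| |]//=;
  rewrite ?leey ?leNye//.
by rewrite -!EFinD !lee_fin; lra.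
Qed.

Lemma hull_le f x : X x -> (hullf f x <= f x)%E.
Proof. by move=> Xx; apply: hull_leP => // y; exact: left_env_le. Qed.

(** By [left_env_le_hull] and [hull_le] the inequality
    [env y <= hull x + D x y / lambda <= f x + D x y / lambda] holds
    throughout, so attainment for [f] at [x] is attainment for the hull
    together with contact of the hull with [f] at [x]. *)
Lemma left_prox_hull f x y : Y y ->
  left_prox phi lambda f y x <->
  left_prox phi lambda (hullf f) y x /\ hullf f x = f x.
Proof.
move=> Yy; split.
  move=> /left_proxE-/(_ Yy)[Xx envE].
  have hx : hullf f x = f x.
    apply/le_anti; rewrite hull_le//=.
    by have := left_env_le_hull f Xx Yy; rewrite envE leeD2rE.
  split=> //; split=> // z Xz; rewrite !bregmanE// -!EFinM hx -envE.
  exact: left_env_le_hull.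
move=> [[Xx H] hx]; split=> // z Xz; rewrite -hx.
by rewrite (le_trans (H z Xz))// leeD2r// hull_le.
Qed.

Lemma tilt_le h x (c : R) : X x ->
  (lambda%:E * h x + phi x <= c%:E)%E = (h x <= ((c - P x) / lambda)%:E)%E.
Proof.
move=> Xx; rewrite (dom_fineK phi_dgf Xx); case: (h x) => [r| |].
- by rewrite -EFinM -EFinD !lee_fin ler_pdivlMr// lerBrDr mulrC.
- by rewrite mulry gtr0_sg// mul1e.
- by rewrite mulrNy gtr0_sg// mul1e !leNye.
Qed.

Lemma tilt_ge h x (c : R) : X x ->
  (c%:E <= lambda%:E * h x + phi x)%E = (((c - P x) / lambda)%:E <= h x)%E.
Proof.
move=> Xx; rewrite (dom_fineK phi_dgf Xx); case: (h x) => [r| |].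
- by rewrite -EFinM -EFinD !lee_fin ler_pdivrMr// lerBlDr mulrC.
- by rewrite mulry gtr0_sg// mul1e !leey.
- by rewrite mulrNy gtr0_sg// mul1e.
Qed.

Lemma tilt_fin h x : X x -> h x \is a fin_num ->
  (lambda%:E * h x + phi x)%E = (lambda * fine (h x) + P x)%:E.
Proof. by move=> Xx hx; rewrite (dom_fineK phi_dgf Xx) -{1}(fineK hx). Qed.

(** Expanding the Bregman distance in the level inequality collects [phi] with
    [lambda * h] on both sides. *)
Lemma level_subgradient h x u : Y x -> h x \is a fin_num ->
  left_level_subdiff phi lambda h x u <->
  forall z, X z -> ((lambda%:E * h x + phi x) +
     (dot (lambda *: u + G x) (z - x))%:E <= lambda%:E * h z + phi z)%E.
Proof.
move=> Yx hx.
have key z : X z -> (((lambda%:E * h x + phi x) +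
     (dot (lambda *: u + G x) (z - x))%:E <= lambda%:E * h z + phi z) =
   (h x + (dot u (z - x)) %:E - lambda^-1%:E * bregman phi z x <= h z))%E.
  move=> Xz; rewrite (tilt_fin (int_dom Yx) hx) -EFinD tilt_ge// bregmanE//.
  rewrite -[X in _ = (X + _ - _ <= _)%E](fineK hx) -EFinM -!EFinD.
  congr (_%:E <= _)%E.
  by rewrite /bregman_fine dotDl dotZl; field; rewrite gt_eqF.
by split=> [[_ H] z Xz|H]; [|split=> // z Xz]; have := H z Xz; rewrite key.
Qed.

(** The Bregman distance to [x] vanishes to first order at [x]. *)
Lemma level_frechet h x u : h x \is a fin_num ->
  left_level_subdiff phi lambda h x u -> frechet_subdiff X h x u.
Proof.
move=> hx [Yx H]; apply/frechetP; split=> //; first exact: int_dom.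
move=> e e0; have le0 : 0 < lambda * e by rewrite mulr_gt0.
apply: filterS (dgf_expansion phi_dgf Yx le0) => z + Xz.
rewrite ler_norml => /andP[_ Dz]; apply: le_trans (H z Xz).
rewrite bregmanE// -addeA leeD2lE// -EFinM -EFinB lee_fin lerD2l lerN2.
by rewrite ler_pdivrMl// mulrA.
Qed.

(** Adding the differentiable function [phi] shifts subgradients by its
    gradient. *)
Lemma frechet_tilt h x v : Y x -> frechet_subdiff X h x v ->
  frechet_subdiff X (fun x => lambda%:E * h x + phi x)%E x (lambda *: v + G x).
Proof.
move=> Yx /frechetP[Xx hx H]; apply/frechetP; split=> //.
  by rewrite tilt_fin.
move=> e e0.
have e2 : 0 < e / 2 by rewrite divr_gt0.
have e2l : 0 < e / 2 / lambda by rewrite divr_gt0.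
apply: filterS2 (H _ e2l) (dgf_expansion phi_dgf Yx e2) => z Hz + Xz.
rewrite ler_norml => /andP[Pz _]; rewrite tilt_fin// -EFinD tilt_ge//.
apply: le_trans (Hz Xz); rewrite -{2}(fineK hx) -EFinD lee_fin.
rewrite ler_pdivrMr// dotDl dotZl.
have -> : (fine (h x) + (dot v (z - x) - e / 2 / lambda * `|z - x|)) * lambda
  = lambda * fine (h x) + lambda * dot v (z - x) - e / 2 * `|z - x|.
  by field; rewrite gt_eqF.
lra.
Qed.

(** The limiting version of [frechet_tilt] needs [grad phi] to be continuous at
    [x], and the tail of the sequence to lie in the interior of the domain. *)
Lemma limiting_tilt h x v : Y x -> h x \is a fin_num ->
  limiting_subdiff X h x v ->
  limiting_subdiff X (fun x => lambda%:E * h x + phi x)%E x (lambda *: v + G x).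
Proof.
move=> Yx hx [Xx _ [x_ [v_ [fr xx hh vv]]]]; split=> //.
  by rewrite tilt_fin// ltry.
have [N _ NY] := xx _ (nbhs_int_dom Yx).
exists (fun k => x_ (k + N)%N),
  (fun k => lambda *: v_ (k + N)%N + G (x_ (k + N)%N)).
have fr' k := fr (k + N)%N.
have YN k : Y (x_ (k + N)%N) by apply: NY; rewrite /= leq_addl.
have xxN : x_ (k + N)%N @[k --> \oo] --> x by rewrite (cvg_shiftn N x_).
have fin k : h (x_ (k + N)%N) \is a fin_num by have [] := fr' k.
split.
- by move=> k; apply: frechet_tilt.
- exact: xxN.
- have -> : (fun x => lambda%:E * h x + phi x)%E \o (fun k => x_ (k + N)%N) =
      (fun k => (lambda * fine (h (x_ (k + N)%N)) + P (x_ (k + N)%N))%:E).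
    by apply/funext => k /=; rewrite tilt_fin//; exact: int_dom.
  rewrite tilt_fin//; apply: cvg_EFin; first exact: nearW.
  apply: cvgD; last first.
    exact: (continuous_cvg _ (dgf_continuous phi_dgf Yx) xxN).
  apply: cvgM; first exact: cvg_cst.
  apply: fine_cvg; rewrite fineK//.
  by rewrite (cvg_shiftn N (h \o x_)).
- apply: cvgD.
    by apply: cvgZ; [exact: cvg_cst | rewrite (cvg_shiftn N v_)].
  exact: (continuous_cvg _ (grad_continuous phi_dgf Yx) xxN).
Qed.

End Bregman.

(** * Limiting subgradients of convex functions and hulls *)

Section ConvexSubgradients.
Context {R : realType} {n : nat}.
Implicit Types (h : 'rV[R]_n -> \bar R) (A : set 'rV[R]_n) (x v : 'rV[R]_n).

(** Each Fréchet subgradient in the approximating sequence is global by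
    [frechet_convex], and global inequalities pass to the limit. *)
Lemma limiting_convex A h x v : cvx_dom A -> convex_on A h ->
  h x \is a fin_num -> limiting_subdiff A h x v ->
  forall z, A z -> (h x + (dot v (z - x))%:E <= h z)%E.
Proof.
move=> cA ch hx [Ax _ [x_ [v_ [fr xx hh vv]]]] z Az.
have le_z k := frechet_convex cA ch (fr k) Az.
have fin k : h (x_ k) \is a fin_num by have [] := fr k.
case hz : (h z) => [s| |]; last 2 first.
- exact: leey.
- by have := le_z 0%N; rewrite hz -(fineK (fin 0%N)).
rewrite -(fineK hx) -EFinD lee_fin.
apply: (@cvg_affine_le _ _ (fun k => fine (h (x_ k))) x_ v_) => //.
- by apply: fine_cvg; rewrite fineK.
- apply: nearW => k; have := le_z k.
  by rewrite hz -(fineK (fin k)) -EFinD lee_fin.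
Qed.

Lemma dual_adde_le (a b c d : \bar R) : (a <= c)%E -> (b <= d)%E ->
  (dual_adde a b <= dual_adde c d)%E.
Proof.
rewrite /dual_adde.
case: a => [a| |]; case: c => [c| |]; case: b => [b| |]; case: d => [d| |] //=;
  rewrite ?leey ?leNye// !lee_fin; exact: lerD.
Qed.

(** A supremum of convex functions is convex. *)
Lemma convex_conv_on A h : convex_on A (conv_on A h).
Proof.
move=> x y t Ax Ay t01; have /andP[t0 t1] := t01.
apply: ge_ereal_sup => _ [k [ck kh] <-].
apply: le_trans (ck _ _ _ Ax Ay t01) _; apply: dual_adde_le.
  apply: lee_wpmul2l; first by rewrite lee_fin ltW.
  by apply: ereal_sup_ubound; exists k.
apply: lee_wpmul2l; first by rewrite lee_fin subr_ge0 ltW.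
by apply: ereal_sup_ubound; exists k.
Qed.

Lemma conv_on_le A h x : A x -> (conv_on A h x <= h x)%E.
Proof. by move=> Ax; apply: ge_ereal_sup => _ [k [_ kh] <-]; exact: kh. Qed.

(** The affine minorant touching [h] at [x] is one of the convex functions
    below [h], so it also lies below the convex hull, which it forces to meet
    [h] at [x]. *)
Lemma subgradient_conv_on A h x v : A x -> h x \is a fin_num ->
  (forall z, A z -> (h x + (dot v (z - x))%:E <= h z)%E) ->
  limiting_subdiff A (conv_on A h) x v /\ conv_on A h x = h x.
Proof.
move=> Ax hx H.
have affine_le z : (h x + (dot v (z - x))%:E <= conv_on A h z)%E.
  apply: ereal_sup_ubound; exists (fun z => h x + (dot v (z - x))%:E)%E => //.
  split=> // y z' t _ _ t01.
  rewrite -(fineK hx) -!EFinD -!EFinM lee_fin !dotE.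
  rewrite le_eqVlt; apply/orP; left; apply/eqP; ring.
have cx : conv_on A h x = h x.
  apply/le_anti; rewrite conv_on_le//=.
  by have := affine_le x; rewrite subrr dot0r adde0.
split=> //; apply/limiting_frechet/frechetP; rewrite cx; split=> // e e0.
apply: (@filterE _ _ (nbhs_filter x)) => z Az; apply: le_trans (affine_le z).
by rewrite leeD2lE// lee_fin gerBl mulr_ge0// ltW.
Qed.

End ConvexSubgradients.

Section HullConvexity.
Context {R : realType} {n : nat} {phi : 'rV[R]_n -> \bar R}.
Context (phi_dgf : dgf phi) {lambda : R} (lambda_gt0 : 0 < lambda).
Implicit Types (x y z u v w : 'rV[R]_n) (f h : 'rV[R]_n -> \bar R).

Local Notation X := (edom phi).
Local Notation Y := (edom phi)°.
Local Notation P x := (fine (phi x)).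

(** The tilted hull is the supremum over [y] in [Y] of the affine functions
    [lambda * env y + phi y + dot (grad phi y) (x - y)]. The proof tests real
    upper bounds against these affine functions, which avoids sums of opposite
    infinities. *)
Lemma convex_tilted_hull f : proper_on X f ->
  convex_on X (fun x => lambda%:E * hull phi lambda f x + phi x)%E.
Proof.
move=> fp x1 x2 t Xx1 Xx2 t01; have /andP[t0 t1] := t01.
pose k x := (lambda%:E * hull phi lambda f x + phi x)%E.
pose m := t *: x1 + (1 - t) *: x2.
have Xm : X m := cvx_dom_dgf phi_dgf Xx1 Xx2 t01.
rewrite -[leLHS]/(k m) -/(k x1) -/(k x2).
have minorant y (E : R) x : Y y -> X x -> left_env phi lambda f y = E%:E ->
    ((lambda * E + P y + dot (grad phi y) (x - y))%:E <= k x)%E.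
  move=> Yy Xx envE; rewrite /k tilt_ge//.
  have := left_env_le_hull phi_dgf (lambda := lambda) f Xx Yy; rewrite envE.
  rewrite -leeBlDr// -EFinB; congr (_%:E <= _)%E.
  by rewrite /bregman_fine; field; rewrite gt_eqF.
have bound (c : R) : (forall y E, Y y -> left_env phi lambda f y = E%:E ->
    lambda * E + P y + dot (grad phi y) (m - y) <= c) -> (k m <= c%:E)%E.
  move=> H; rewrite /k tilt_le//; apply: hull_leP => // y Yy.
  have := left_env_lty phi_dgf (lambda := lambda) fp Yy.
  have := fun E => H y E Yy.
  case: (left_env phi lambda f y) => [E| |]//; last by move=> _ _; exact: leNye.
  move=> /(_ E erefl) Hc _.
  rewrite -EFinD lee_fin.
  have -> : (c - P m) / lambda + lambda^-1 * bregman_fine phi m y =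
      (c - P y - dot (grad phi y) (m - y)) / lambda.
    by rewrite /bregman_fine; field; rewrite gt_eqF.
  by rewrite ler_pdivlMr//; lra.
move: (grad phi) minorant bound => g minorant bound.
(* If the envelope never takes a finite value, the hull is identically [-oo]. *)
have [[y [E [Yy envE]]]|none] :=
    pselect (exists y E, Y y /\ left_env phi lambda f y = E%:E); last first.
  suff -> : k m = -oo%E by exact: leNye.
  apply/eqP; rewrite -leeNy_eq leNgt; apply/negP => km.
  have below c : (k m <= c%:E)%E.
    by apply: bound => y E Yy envE; case: none; exists y, E.
  have kfin : k m \is a fin_num.
    by rewrite fin_numElt km (le_lt_trans (below 0)) ?ltry.
  have := below (fine (k m) - 1).
  by rewrite -{1}(fineK kfin) lee_fin lerBrDr gerDl ler10.
have := minorant y E x1 Yy Xx1 envE; have := minorant y E x2 Yy Xx2 envE.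
case k2 : (k x2) => [r2| |]//; case k1 : (k x1) => [r1| |]// _ _.
- rewrite -!EFinM /dual_adde; apply: bound => y' E' Yy' envE'.
  have := minorant y' E' x1 Yy' Xx1 envE'.
  have := minorant y' E' x2 Yy' Xx2 envE'.
  rewrite k1 k2 !lee_fin => le2 le1.
  have -> : lambda * E' + P y' + dot (g y') (m - y') =
      t * (lambda * E' + P y' + dot (g y') (x1 - y')) +
      (1 - t) * (lambda * E' + P y' + dot (g y') (x2 - y')).
    by rewrite /m !dotE; ring.
  by apply: lerD; apply: ler_wpM2l => //; rewrite ?subr_ge0 ltW.
- by rewrite mulry gtr0_sg// mul1e -EFinM leey.
- by rewrite mulry gtr0_sg ?subr_gt0// mul1e -EFinM leey.
- by rewrite !gt0_muley ?lte_fin ?subr_gt0// leey.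
Qed.

End HullConvexity.
(** * The equivalences *)

Theorem theorem3p9 (R : realType) (n : nat) (phi : 'rV[R]_n -> \bar R)
    (phi_dgf : dgf phi) (phi_coercive : one_coercive phi)
    (phi_legendre : legendre phi)
    (f : 'rV[R]_n -> \bar R)
    (f_proper : proper_on (edom phi) f) (f_lsc : lsc_on (edom phi) f)
    (f_bounded : prox_bounded phi f)
    (lambda : R) (lambda_gt0 : 0 < lambda)
    (lambda_lt : (lambda%:E < prox_threshold phi f)%E)
    (xbar : 'rV[R]_n) (xbar_int : (edom phi)° xbar) (ubar : 'rV[R]_n)
    (ybar : 'rV[R]_n)
    (ybarE : ybar = grad (conjugate phi) (lambda *: ubar + grad phi xbar)) :
  [<-> (* (a) *)
       left_level_subdiff phi lambda f xbar ubar;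
       (* (b) *)
       left_prox phi lambda f ybar xbar;
       (* (c) *)
       right_level_subdiff phi lambda (fun y => - left_env phi lambda f y)%E
         ybar (lambda^-1 *: (xbar - ybar)) /\
       set_dom (left_level_subdiff phi lambda f) xbar;
       (* (d) *)
       right_prox phi lambda (fun y => - left_env phi lambda f y)%E xbar ybar /\
       set_dom (left_level_subdiff phi lambda f) xbar;
       (* (e) *)
       left_prox phi lambda (hull phi lambda f) ybar xbar /\
       hull phi lambda f xbar = f xbar;
       (* (f) *)
       limiting_subdiff (edom phi) (hull phi lambda f) xbar ubar /\
       hull phi lambda f xbar = f xbar;
       (* (g) *)
       limiting_subdiff (edom phi)
         (conv_on (edom phi) (fun x => lambda%:E * f x + phi x)%E)
         xbar (grad phi ybar) /\
       conv_on (edom phi) (fun x => lambda%:E * f x + phi x)%E xbar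
         = (lambda%:E * f xbar + phi xbar)%E].
Proof.
have lambda_ge0 := ltW lambda_gt0.
have [] := grad_conjugate_inverse phi_dgf (lambda *: ubar + grad phi xbar)
  phi_coercive phi_legendre.
rewrite -ybarE => Yybar gradybar.
have Xxbar := int_dom xbar_int.
have ab : left_level_subdiff phi lambda f xbar ubar <->
    left_prox phi lambda f ybar xbar by exact: level_prox.
(* Any level subgradient [u] at [xbar] puts [xbar] in the left prox of a point,
   whether or not [u] is [ubar]. *)
have dom_prox : set_dom (left_level_subdiff phi lambda f) xbar ->
    exists2 y, (edom phi)° y & left_prox phi lambda f y xbar.
  move=> [u fu].
  have [Yy Gy] := grad_conjugate_inverse phi_dgf (lambda *: u + grad phi xbar)
    phi_coercive phi_legendre.
  by exists (grad (conjugate phi) (lambda *: u + grad phi xbar)) => //;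
    apply/(level_prox phi_dgf lambda_gt0 f xbar_int Yy Gy).
have cd := right_level_prox phi_dgf (lambda := lambda)
  (fun y => - left_env phi lambda f y)%E Xxbar Yybar.
have fbar_gt : (-oo < f xbar)%E by exact: f_proper.2.
split; [|split; [|split; [|split; [|split; [|split]]]]].
- exact: ab.1.
- move=> px; split; last by exists ubar; exact: ab.2.
  by apply/cd; exact: left_prox_right_prox.
- by move=> [/cd].
- move=> [rp /dom_prox[y' Yy' px']].
  apply/(left_prox_hull phi_dgf (lambda := lambda) f xbar Yybar).
  exact: right_prox_left_prox px' rp.
- move=> [hp hE]; split=> //.
  have px : left_prox phi lambda f ybar xbar.
    by apply/(left_prox_hull phi_dgf (lambda := lambda) f xbar Yybar).
  apply: limiting_frechet; apply: (level_frechet phi_dgf lambda_gt0).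
    by rewrite hE; exact: left_prox_fin_num px.
  by apply/(level_prox phi_dgf lambda_gt0 (hull phi lambda f) xbar_int
    Yybar gradybar).
- move=> [lim hE].
  have hfin : hull phi lambda f xbar \is a fin_num.
    by rewrite fin_numElt hE fbar_gt -hE; case: lim.
  have ffin : f xbar \is a fin_num by rewrite -hE.
  have Ffin : (lambda%:E * f xbar + phi xbar)%E \is a fin_num by rewrite tilt_fin.
  rewrite gradybar.
  apply: (subgradient_conv_on (h := fun x => lambda%:E * f x + phi x)%E) => // z Xz.
  have := limiting_convex (cvx_dom_dgf phi_dgf)
    (convex_tilted_hull phi_dgf lambda_gt0 f_proper) _
    (limiting_tilt phi_dgf lambda_gt0 xbar_int hfin lim) Xz.
  rewrite hE => /(_ Ffin) /le_trans; apply.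
  by rewrite leeD2r// lee_wpmul2l// hull_le.
- move=> [lim cE].
  have [_ + _] := lim; rewrite cE => Flt.
  have ffin : f xbar \is a fin_num.
    rewrite fin_numElt fbar_gt; case: (f xbar) Flt => [r| |]//.
      by rewrite ltry.
    by rewrite mulry gtr0_sg// mul1e (dom_fineK phi_dgf Xxbar).
  apply/(level_subgradient phi_dgf lambda_gt0 _ xbar_int ffin) => z Xz.
  rewrite -gradybar -cE.
  have cfin :
      conv_on (edom phi) (fun x => lambda%:E * f x + phi x)%E xbar \is a fin_num.
    by rewrite cE tilt_fin.
  have := conv_on_le (fun x => lambda%:E * f x + phi x)%E Xz.
  apply: le_trans.
  exact: (limiting_convex (cvx_dom_dgf phi_dgf) (@convex_conv_on _ _ _ _)
    cfin lim Xz).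
Qed.
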